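(* Let $X$ be a real Banach space, let $f:[a,b]\to X$, and suppose that $md(f,\cdot)$ is continuous at $x\in[a,b]$. Then $$\|f(y)-f(z)\|-md(f,x)|y-z|=o(|x-z|+|x-y|)$$ as $(y,z)\to(x,x)$ with $y,z\in[a,b]$ and $\operatorname{sign}(z-x)=\operatorname{sign}(y-x)$.
   Context: For $f:[a,b]\to X$, the unilateral metric derivatives are $md_{\pm}(f,x)=\lim_{t\to0+}\frac{\|f(x\pm t)-f(x)\|}{t}$. If both exist and are equal (and finite), their common value is the metric derivative $md(f,x)$; at an endpoint of $[a,b]$ only the one-sided limit taken inside $[a,b]$ is used. ''$md(f,\cdot)$ is continuous at $x$'' means that $md(f,s)$ exists for all $s\in[a,b]$ in some neighbourhood of $x$ and $md(f,s)\to md(f,x)$ as $s\to x$, $s\in[a,b]$. *)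

(* Defs.v *)
From HB Require Import structures.
From mathcomp Require Import all_boot all_order all_algebra.
From mathcomp Require Import all_classical all_reals all_analysis.

Set Implicit Arguments.
Unset Strict Implicit.
Unset Printing Implicit Defensive.

Import Order.TTheory GRing.Theory Num.Theory.
Import numFieldNormedType.Exports.

Local Open Scope classical_set_scope.
Local Open Scope ring_scope.

Section MetricDerivative.
Context {R : realType} {X : normedModType R}.

(* A map [a, b] -> X is represented by a total function f : R -> X; for
   x in [a, b], has_md a b f x and md a b f x depend only on the values of f
   on [a, b], since each one-sided limit is used only on a side of x on which
   [a, b] contains a neighbourhood of x. *)
Implicit Types (a b x t : R) (f : R -> X).

Definition md_quot_plus f x t : R := `|f (x + t) - f x| / t.
Definition md_quot_minus f x t : R := `|f (x - t) - f x| / t.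

(* The limits are taken in R, so convergence includes finiteness. *)
Definition has_md_plus f x : Prop := cvg (md_quot_plus f x t @[t --> 0^'+]).
Definition has_md_minus f x : Prop := cvg (md_quot_minus f x t @[t --> 0^'+]).

Definition md_plus f x : R := lim (md_quot_plus f x t @[t --> 0^'+]).
Definition md_minus f x : R := lim (md_quot_minus f x t @[t --> 0^'+]).

Definition has_md a b f x : Prop :=
  [/\ x < b -> has_md_plus f x,
      a < x -> has_md_minus f x &
      a < x < b -> md_plus f x = md_minus f x].

(* Meaningful only under has_md a b f x, where the two one-sided values agree
   in the interior; at x = b only the left one is available. *)
Definition md a b f x : R := if x < b then md_plus f x else md_minus f x.

Definition md_continuous_at a b f x : Prop :=
  (\forall s \near within `[a, b] (nbhs x), has_md a b f s) /\
  md a b f s @[s --> within `[a, b] (nbhs x)] --> md a b f x.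

End MetricDerivative.

(* Main.v *)
Require Import Defs.
From HB Require Import structures.
From mathcomp Require Import all_boot all_order all_algebra.
From mathcomp Require Import all_classical all_reals all_analysis.
From mathcomp Require Import lra.

Set Implicit Arguments.
Unset Strict Implicit.
Unset Printing Implicit Defensive.

Import Order.TTheory GRing.Theory Num.Theory.
Import numFieldNormedType.Exports.

Local Open Scope classical_set_scope.
Local Open Scope ring_scope.

(* Write L = md(f, x). Near x the metric derivative is below L + e, so the mean
   value inequality gives |f y - f z| <= (L + e) |y - z|. Conversely
   | |f s - f x| - L |s - x| | <= e |s - x| for s near x, and when y and z lie on
   the same side of x, |y - z| is the difference of their distances to x; the
   triangle inequality through f x gives the lower bound. *)

Section MeanValue.
Context {R : realType} {X : normedModType R}.
Implicit Types (a b x y z s t K L e d : R) (f : R -> X).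

Lemma cvg_at_right0_close (q : R -> R) L e : 0 < e ->
  q t @[t --> 0^'+] --> L ->
  exists2 d, 0 < d & forall t, 0 < t < d -> `|L - q t| < e.
Proof.
move=> e0 /cvgrPdist_lt /(_ e e0) [d /= d0 Hd].
exists d => // t /andP[t0 td]; apply: Hd => //=.
by rewrite sub0r normrN gtr0_norm.
Qed.

(* The supremum of the points that satisfy the bound satisfies it because of
   the left hypothesis, and equals z because of the right one. *)
Lemma metric_mean_value f y z K : y <= z ->
  (forall s, y <= s < z ->
    exists2 d, 0 < d & forall t, 0 < t < d -> `|f (s + t) - f s| <= K * t) ->
  (forall s, y < s <= z ->
    exists2 d, 0 < d & forall t, 0 < t < d -> `|f (s - t) - f s| <= K * t) ->
  `|f z - f y| <= K * (z - y).
Proof.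
move=> yz fr fl.
pose S : set R := [set s | [/\ y <= s, s <= z & `|f s - f y| <= K * (s - y)]].
have Sy : S y by split=> //; rewrite !subrr normr0 mulr0.
have supS : has_sup S by split; [exists y | exists z => s []].
have ubS := ub_le_sup supS.2.
set c := sup S in ubS.
have yc : y <= c by exact: ubS.
have cz : c <= z by apply: ge_sup; [exists y | move=> s []].
have Sc : S c.
  have [<-//|yc'] := eqVneq y c.
  have [|d d0 Hd] := fl c; first by rewrite lt_neqAle yc' yc cz.
  have [s [ys sz Hs] cs] := sup_adherent d0 supS.
  have sc : s <= c by exact: ubS.
  have [<-//|nsc] := eqVneq s c.
  have sc' : s < c by rewrite lt_neqAle nsc.
  have /Hd : 0 < c - s < d by rewrite -/c in cs; apply/andP; split; lra.
  rewrite subKr => H; split=> //.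
  have := ler_distD (f s) (f c) (f y); rewrite (distrC (f c) (f s)); nra.
have [<-|ncz] := eqVneq c z; first by case: Sc.
have [|d d0 Hd] := fr c; first by rewrite yc lt_neqAle ncz.
have cltz : c < z by rewrite lt_neqAle ncz.
pose t := Num.min (d / 2) (z - c).
have t0 : 0 < t by rewrite lt_min; apply/andP; split; lra.
have [td tz] : t <= d / 2 /\ t <= z - c by rewrite !ge_min !lexx orbT.
have Ht : `|f (c + t) - f c| <= K * t by apply: Hd; rewrite t0; lra.
have : S (c + t).
  case: Sc => _ _ Hc; split; [lra|lra|].
  have := ler_distD (f c) (f (c + t)) (f y); nra.
by move/ubS => h; exfalso; lra.
Qed.

Lemma has_md_right_close a b f s e : 0 < e -> has_md a b f s -> s < b ->
  exists2 d, 0 < d & forall t, 0 < t < d ->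
    `| `|f (s + t) - f s| - md a b f s * t| <= e * t.
Proof.
move=> e0 [hp _ _] sb; rewrite /md sb.
have [d d0 Hd] := cvg_at_right0_close e0 (hp sb).
exists d => // t td; have /andP[t0 _] := td.
rewrite -(ler_pdivrMr _ _ t0) -[X in _ / X](gtr0_norm t0) -normrV ?unitf_gt0//.
rewrite -normrM mulrBl mulfK ?gt_eqF// distrC.
exact/ltW/Hd.
Qed.

Lemma has_md_left_close a b f s e : 0 < e -> has_md a b f s -> a < s <= b ->
  exists2 d, 0 < d & forall t, 0 < t < d ->
    `| `|f (s - t) - f s| - md a b f s * t| <= e * t.
Proof.
move=> e0 [_ hm hpm] /andP[as_ sb].
have -> : md a b f s = md_minus f s.
  by rewrite /md; case: ifP => // sb'; apply: hpm; rewrite as_.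
have [d d0 Hd] := cvg_at_right0_close e0 (hm as_).
exists d => // t td; have /andP[t0 _] := td.
rewrite -(ler_pdivrMr _ _ t0) -[X in _ / X](gtr0_norm t0) -normrV ?unitf_gt0//.
rewrite -normrM mulrBl mulfK ?gt_eqF// distrC.
exact/ltW/Hd.
Qed.

Lemma has_md_close a b f x e : 0 < e -> has_md a b f x ->
  x \in `[a, b] ->
  exists2 d, 0 < d & forall s, s \in `[a, b] -> `|x - s| < d ->
    `| `|f s - f x| - md a b f x * `|s - x| | <= e * `|s - x|.
Proof.
move=> e0 hf; rewrite in_itv/= => /andP[ax xb].
have [d1 d10 H1] : exists2 d, 0 < d & forall t, x < b -> 0 < t < d ->
    `| `|f (x + t) - f x| - md a b f x * t| <= e * t.
  have [xb'|bx] := ltP x b; last by exists 1.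
  by have [d d0 H] := has_md_right_close e0 hf xb'; exists d => // t _ /H.
have [d2 d20 H2] : exists2 d, 0 < d & forall t, a < x -> 0 < t < d ->
    `| `|f (x - t) - f x| - md a b f x * t| <= e * t.
  have [ax'|xa] := ltP a x; last by exists 1.
  have [|d d0 H] := has_md_left_close e0 hf (s := x); first by rewrite ax'.
  by exists d => // t _ /H.
exists (Num.min d1 d2); first by rewrite lt_min d10.
move=> s; rewrite in_itv/= lt_min => /andP[as_ sb] /andP[sd1 sd2].
have [sx|xs|<-] := ltgtP s x; last by rewrite !subrr !normr0 !mulr0 subrr normr0.
- have t0 : 0 < x - s by rewrite subr_gt0.
  rewrite (distrC s x) (gtr0_norm t0) -{1}(subKr x s).
  by apply: H2; [exact: le_lt_trans sx | rewrite t0 -(gtr0_norm t0)].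
- have t0 : 0 < s - x by rewrite subr_gt0.
  rewrite distrC (gtr0_norm t0) in sd1.
  rewrite (gtr0_norm t0) -{1}(subrKC x s).
  by apply: H1; [exact: lt_le_trans sb | rewrite t0].
Qed.

Lemma md_lipschitz a b f y z K : a <= y -> y <= z -> z <= b ->
  (forall s, y <= s <= z -> has_md a b f s /\ md a b f s < K) ->
  `|f z - f y| <= K * (z - y).
Proof.
move=> ay yz zb H; apply: metric_mean_value => // s /andP[ys sz].
- have [|hs sK] := H s; first by rewrite ys ltW.
  have [||d d0 Hd] := has_md_right_close _ hs (e := K - md a b f s).
  + by rewrite subr_gt0.
  + exact: lt_le_trans zb.
  exists d => // t /Hd; rewrite ler_norml => /andP[_].
  by rewrite mulrBl lerD2r.
- have [|hs sK] := H s; first by rewrite sz ltW.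
  have [||d d0 Hd] := has_md_left_close _ hs (e := K - md a b f s).
  + by rewrite subr_gt0.
  + by rewrite (le_lt_trans ay ys) (le_trans sz zb).
  exists d => // t /Hd; rewrite ler_norml => /andP[_].
  by rewrite mulrBl lerD2r.
Qed.

End MeanValue.

Theorem lemma4p4 (R : realType) (X : completeNormedModType R)
    (a b : R) (f : R -> X) (x : R)
    (hx : x \in `[a, b])
    (hmd : md_continuous_at a b f x) :
  (fun yz : R * R =>
     `|f yz.1 - f yz.2| - md a b f x * `|yz.1 - yz.2|)
  =o_ (within [set yz : R * R | [/\ yz.1 \in `[a, b], yz.2 \in `[a, b] &
                                  Num.sg (yz.2 - x) = Num.sg (yz.1 - x)]]
        (nbhs (x, x)))
  (fun yz : R * R => `|x - yz.2| + `|x - yz.1|).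
Proof.
have [hmd1 hmd2] := hmd.
apply/eqoP => e e0.
have hfx : has_md a b f x.
  exact: (nbhs_singleton hmd1).
have [d1 /= d10 H1] := hmd1.
have /cvgrPdist_lt/(_ e e0)[d2 /= d20 H2] := hmd2.
have [d3 d30 H3] := has_md_close e0 hfx hx.
set L := md a b f x in H2 H3 *.
pose d := Num.min d1 (Num.min d2 d3).
have d0 : 0 < d by rewrite !lt_min d10 d20.
have lip y z : y \in `[a, b] -> z \in `[a, b] -> `|x - y| < d -> `|x - z| < d ->
    `|f y - f z| <= (L + e) * `|y - z|.
  wlog yz : y z / z <= y.
    move=> h ya za yd zd; have [/h|/ltW/h] := leP z y; first exact.
    by rewrite (distrC y) (distrC (f y)); exact.
  rewrite !in_itv/= => /andP[ay yb] /andP[az zb] yd zd.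
  rewrite (ger0_norm (_ : 0 <= y - z)) ?subr_ge0//.
  apply: (md_lipschitz (a := a) (b := b)) => // s /andP[zs sy].
  have sab : s \in `[a, b] by rewrite in_itv/= (le_trans az zs) (le_trans sy yb).
  have sd : `|x - s| < d.
    by move: yd zd; rewrite !ltr_norml => /andP[? ?] /andP[? ?]; lra.
  move: sd; rewrite !lt_min => /and3P[sd1 sd2 _].
  split; first exact: H1.
  by have := H2 s sd2 sab; rewrite ltr_norml => /andP[]; lra.
exists (ball x d, ball x d); first by split; exact: nbhsx_ballx.
move=> [y z] /= [yd zd] [ya za sg]; rewrite /ball/= in yd zd.
rewrite [leRHS](_ : _ = e * (`|x - z| + `|x - y|)); last first.
  by congr (_ * _); rewrite ger0_norm// addr_ge0.
have up := lip y z ya za yd zd.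
have yd3 : `|x - y| < d3 by move: yd; rewrite !lt_min => /and3P[].
have zd3 : `|x - z| < d3 by move: zd; rewrite !lt_min => /and3P[].
move: (H3 y ya yd3) (H3 z za zd3).
rewrite !ler_norml => /andP[y1 y2] /andP[z1 z2].
have t1 := ler_distD (f z) (f y) (f x).
have t2 := ler_distD (f y) (f z) (f x).
rewrite (distrC (f z) (f y)) in t2.
have dyz : e * `|y - z| <= e * (`|z - x| + `|y - x|).
  apply: ler_wpM2l; first exact: ltW.
  by rewrite (distrC z x) [leRHS]addrC; exact: ler_distD.
rewrite (distrC x z) (distrC x y).
have dst : `|y - z| = `| `|y - x| - `|z - x| |.
  have [yx|yx] := eqVneq y x.
    move: sg; rewrite yx subrr sgr0 => /eqP; rewrite sgr_eq0 subr_eq0 => /eqP ->.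
    by rewrite !subrr normr0.
  have -> : y - z = Num.sg (y - x) * (`|y - x| - `|z - x|).
    by rewrite mulrBr -{2}sg -!numEsg; lra.
  by rewrite normrM normr_sg subr_eq0 yx mul1r.
rewrite dst in up dyz *; move: up dyz.
by case: (ler0P (`|y - x| - `|z - x|)) => _ up dyz; apply/andP; split; lra.
Qed.
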